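(* Let $G=(V,E)$ be a finite simple directed graph that is acyclic and transitively reduced, and let $G^*$ denote its transitive closure. Apply the sequential flow and parallel flow rules to $G$ until neither applies. Then every prime-free module $M$ of $G^*$ is eliminated, i.e. all vertices of $M$ are merged into a single vertex of the reduced graph.
   Context: Sequential flow rule: if $b$ is the only successor of $a$ and $a$ the only predecessor of $b$, merge $a$ and $b$. Parallel flow rule: if $a\neq b$ have the same sets of predecessors and successors, merge $a$ and $b$. Merging $a,b$ replaces them by one vertex whose predecessors (successors) are the predecessors (successors) of $a$ or $b$ other than $a,b$. $G$ is transitively reduced if no arc $(a,c)\in E$ has a directed path of length at least 2 from $a$ to $c$. The transitive closure $G^*=(V,E^* )$ has $E^*$ the minimal transitive superset of $E$ (transitive: $(a,b),(b,c)\in E^*$, $a\neq c$ imply $(a,c)\in E^*$). A module of a graph $H=(V,E)$ is a non-empty $M\subseteq V$ such that each $x\notin M$ has the same predecessor/successor relationship to all vertices of $M$; modules overlap if they intersect but neither contains the other; strong modules overlap no module. The modular decomposition tree has the strong modules as nodes ordered by inclusion; a non-leaf node $N$ is prime if its child quotient graph (vertices: maximal strong modules properly contained in $N$; arc $A\to B$ iff there is an arc from $A$ to $B$) has no modules other than its vertex set and singletons, with more than... i.e. it is neither complete, edgeless, nor a total order. A prime module is a strong module whose node is prime. A graph is prime-free if it contains no prime modules; a module $M$ of $H$ is prime-free if the induced subgraph $H|M$ is prime-free. *)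

(* Defs.v *)
From HB Require Import structures.
From mathcomp Require Import all_boot.

Set Implicit Arguments.
Unset Strict Implicit.
Unset Printing Implicit Defensive.

(* A digraph with vertex set [vset] inside a finite carrier. Only the values of
   [arc] between elements of [vset] are meaningful, and every notion below reads
   [arc] only there. *)
Record digraph (T : finType) := Digraph { vset : {set T}; arc : rel T }.

Section Relations.
Variables (T : finType) (e : rel T).

Definition acyclic : Prop := forall c : seq T, ucycle e c -> c = [::].

Definition transitively_reduced : Prop :=
  forall (a c : T) (p : seq T),
    e a c -> path e a p -> uniq (a :: p) -> last a p = c -> ~~ (1 < size p).

Definition off_diag_transitive (F : {set T * T}) : bool :=
  [forall a, forall b, forall c,
    [&& (a, b) \in F, (b, c) \in F & a != c] ==> ((a, c) \in F)].

(* The transitive supersets of [e] are closed under intersection, so the minimal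
   one is the intersection of all of them. *)
Definition trans_closure : rel T :=
  [rel x y | [forall F : {set T * T},
    ([forall a, forall b, e a b ==> ((a, b) \in F)] && off_diag_transitive F)
      ==> ((x, y) \in F)]].

Lemma trans_closure_sub : subrel e trans_closure.
Proof.
move=> x y exy; apply/forallP => F; apply/implyP => /andP[/forallP sub _].
by have /forallP/(_ y)/implyP := sub x; apply.
Qed.

Lemma trans_closure_trans a b c :
  trans_closure a b -> trans_closure b c -> a != c -> trans_closure a c.
Proof.
move=> /forallP ab /forallP bc ac; apply/forallP => F; apply/implyP => hF.
have Fab := implyP (ab F) hF; have Fbc := implyP (bc F) hF.
case/andP: hF => _ /forallP/(_ a)/forallP/(_ b)/forallP/(_ c)/implyP; apply.
by rewrite Fab Fbc.
Qed.

Lemma trans_closure_min (r : rel T) :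
  subrel e r -> (forall a b c, r a b -> r b c -> a != c -> r a c) ->
  subrel trans_closure r.
Proof.
move=> er rt x y /forallP/(_ [set u | r u.1 u.2]).
rewrite inE /= => /implyP; apply; apply/andP; split.
  by do 2![apply/forallP => ?]; apply/implyP; rewrite inE => /er.
do 3![apply/forallP => ?]; rewrite !inE; apply/implyP => /and3P[]; exact: rt.
Qed.

End Relations.

Section Modules.
Variables (T : finType) (H : digraph T).

Definition is_module (M : {set T}) : bool :=
  [&& M != set0, M \subset vset H &
    [forall x in vset H :\: M, forall y in M, forall z in M,
      (arc H x y == arc H x z) && (arc H y x == arc H z x)]].

Definition overlap (A B : {set T}) : bool :=
  [&& A :&: B != set0, ~~ (A \subset B) & ~~ (B \subset A)].

Definition strong_module (M : {set T}) : bool :=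
  is_module M && [forall B : {set T}, is_module B ==> ~~ overlap M B].

(* The children of [N] in the modular decomposition tree. *)
Definition children (N : {set T}) : {set {set T}} :=
  [set A : {set T} | maxset [pred B | strong_module B && (B \proper N)] A].

Definition child_quotient (N : {set T}) : digraph {set T} :=
  Digraph (children N)
    [rel A B : {set T} | (A != B) && [exists x in A, exists y in B, arc H x y]].

Definition only_trivial_modules : bool :=
  [forall M : {set T}, is_module M ==> (M == vset H) || (#|M| == 1)].

Definition complete : bool :=
  [forall x in vset H, forall y in vset H, (x != y) ==> arc H x y].

Definition edgeless : bool :=
  [forall x in vset H, forall y in vset H, ~~ arc H x y].

(* Strict: the arc relation of a simple graph is irreflexive. *)
Definition total_order : bool :=
  [forall x in vset H, forall y in vset H,
    if x == y then ~~ arc H x y else arc H x y (+) arc H y x] &&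
  [forall x in vset H, forall y in vset H, forall z in vset H,
    arc H x y && arc H y z ==> arc H x z].

Definition induced (M : {set T}) : digraph T := Digraph M (arc H).

End Modules.

Section PrimeFree.
Variables (T : finType) (H : digraph T).

Definition prime_module (N : {set T}) : bool :=
  let Q := child_quotient H N in
  [&& strong_module H N, children H N != set0, only_trivial_modules Q,
      ~~ complete Q, ~~ edgeless Q & ~~ total_order Q].

Definition prime_free : bool := [forall N : {set T}, ~~ prime_module N].

End PrimeFree.

Definition prime_free_module (T : finType) (H : digraph T) (M : {set T}) : bool :=
  is_module H M && prime_free (induced H M).

(* During the reduction a vertex is named by the set of original vertices merged
   into it; these sets always partition the original vertex set, so [a :|: b] is
   a fresh name when [a] and [b] are merged. *)
Section Reduction.
Variable V : finType.
Implicit Types (H : digraph {set V}) (a b : {set V}).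

Definition preds H b : {set {set V}} := [set x in vset H | arc H x b].
Definition succs H a : {set {set V}} := [set y in vset H | arc H a y].

Definition sequential H a b : bool :=
  (succs H a == [set b]) && (preds H b == [set a]).

Definition parallel H a b : bool :=
  (preds H a == preds H b) && (succs H a == succs H b).

Definition applicable H a b : bool :=
  [&& a \in vset H, b \in vset H, a != b & sequential H a b || parallel H a b].

Definition merge H a b : digraph {set V} :=
  let c := a :|: b in
  Digraph (c |: (vset H :\: [set a; b]))
    [rel x y : {set V} |
      if x == c then (y != c) && (y \in (succs H a :|: succs H b) :\: [set a; b])
      else if y == c then x \in (preds H a :|: preds H b) :\: [set a; b]
      else arc H x y].

Inductive reduces_to : digraph {set V} -> digraph {set V} -> Prop :=
| reduces_refl H : reduces_to H H
| reduces_step H a b H' :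
    applicable H a b -> reduces_to (merge H a b) H' -> reduces_to H H'.

Definition irreducible H : Prop := forall a b, ~~ applicable H a b.

Definition initial (E : rel V) : digraph {set V} :=
  Digraph [set [set v] | v in V]
    [rel A B : {set V} | [exists x, exists y, [&& A == [set x], B == [set y] & E x y]]].

End Reduction.

(* Main.v *)
(** Write < for the strict order G^*; G is its Hasse diagram. At every stage of
    the reduction the vertices partition V into modules of <, and the arcs are
    the covering pairs of the quotient order: in a Hasse diagram each flow rule
    merges two elements that are twins (related in the same way to all others),
    hence a two-element module, and contracting twins commutes with taking
    covers. Conversely, any pair of twins makes one of the rules applicable.

    A prime-free module M is series-parallel: a minimal module N that is not
    would be strong with a prime node, since overlapping submodules covering N,
    or an edgeless or totally ordered quotient, would cut N into two smaller
    modules, one entirely below or unrelated to the other. If at the end M met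
    two blocks, pick one point of M in each block meeting M. Series-parallelness
    is hereditary and yields twins among these points; because blocks and M are
    modules, the corresponding blocks are twins in the quotient and a rule still
    applies. *)

Require Import Defs.
From HB Require Import structures.
From mathcomp Require Import all_boot.

Set Implicit Arguments.
Unset Strict Implicit.
Unset Printing Implicit Defensive.

(** * Covers and twins in a finite strict order *)

Definition covers (T : finType) (r : rel T) : rel T :=
  [rel x y | r x y && [forall z, ~~ (r x z && r z y)]].

(** Says that [x] and [y] form a module of [r]. Their mutual relation is left free, so twins may be
    comparable or not. *)
Definition twins (T : finType) (r : rel T) (x y : T) : Prop :=
  forall z, z != x -> z != y -> r z x = r z y /\ r x z = r y z.

Definition converse (T : Type) (r : rel T) : rel T := [rel x y | r y x].

Section Covers.
Variables (T : finType) (r : rel T).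
Hypotheses (r_irr : irreflexive r) (r_tr : transitive r).

Lemma coversP x y :
  reflect (r x y /\ forall z, r x z -> r z y -> False) (covers r x y).
Proof.
apply: (iffP andP) => -[rxy h]; split=> //.
  by move=> z rxz rzy; have /forallP/(_ z) := h; rewrite rxz rzy.
by apply/forallP=> z; apply/negP=> /andP[]; apply: h.
Qed.

Lemma covers_converse x y : covers (converse r) x y = covers r y x.
Proof.
by rewrite /covers /=; congr (_ && _); apply: eq_forallb => z; rewrite andbC.
Qed.

Lemma twins_converse x y : twins r x y -> twins (converse r) x y.
Proof. by move=> h z zx zy; case: (h z zx zy). Qed.

Lemma lt_asym x y : r x y -> r y x -> False.
Proof. by move=> xy yx; have := r_tr xy yx; rewrite r_irr. Qed.

(** Among the elements above [x] and at most [y], one with the fewest elements below it covers [x]: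
    anything in between would be a candidate with fewer. *)
Lemma covers_above x y : r x y -> exists2 z, covers r x z & (z == y) || r z y.
Proof.
move=> rxy; pose P z := r x z && ((z == y) || r z y).
have Py : P y by rewrite /P rxy eqxx.
case: (arg_minnP (fun z => #|[set w | r w z]|) Py) => z /andP[rxz rzy] zmin.
exists z => //; apply/coversP; split=> // w rxw rwz.
have Pw : P w.
  rewrite /P rxw /=; case/orP: rzy => [/eqP <-|rzy]; first by rewrite rwz orbT.
  by rewrite (r_tr rwz rzy) orbT.
have := zmin w Pw; rewrite leqNgt => /negP; apply; apply: proper_card.
apply/properP; split; last by exists w; rewrite inE ?r_irr.
by apply/subsetP=> u; rewrite !inE => /r_tr; apply.
Qed.

End Covers.

(** * Flow rules in terms of covers *)

Section Rules.
Variables (T : finType) (r : rel T).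
Hypotheses (r_irr : irreflexive r) (r_tr : transitive r).

Let conv_irr : irreflexive (converse r). Proof. by move=> x; apply: r_irr. Qed.
Let conv_tr : transitive (converse r).
Proof. by move=> y x z /= xy yz; apply: r_tr yz xy. Qed.

Lemma covers_below x y : r x y -> exists2 z, covers r z y & (z == x) || r x z.
Proof.
move=> rxy; have [z] := @covers_above _ _ conv_irr conv_tr y x rxy.
by rewrite covers_converse; exists z.
Qed.

(** Whatever lies above [x] is reached through a cover of [x], hence through [y]; dually, whatever
    lies below [y] passes through [x]. *)
Lemma sequential_twins x y :
    (forall z, covers r x z = (z == y)) -> (forall z, covers r z y = (z == x)) ->
  twins r x y.
Proof.
move=> cx cy z zx zy.
have /coversP[rxy _] : covers r x y by rewrite cx.
split; apply/idP/idP => [h|h].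
- exact: r_tr h rxy.
- have [w] := covers_below h; rewrite cy => /eqP->.
  by rewrite eq_sym (negPf zx).
- have [w] := covers_above r_irr r_tr h; rewrite cx => /eqP->.
  by rewrite eq_sym (negPf zy).
- exact: r_tr rxy h.
Qed.

(** Every comparison factors through a cover, so common covers on each side give common elements
    below and above. *)
Lemma parallel_twins x y :
    (forall z, covers r z x = covers r z y) ->
    (forall z, covers r x z = covers r y z) -> twins r x y.
Proof.
have below u v z : (forall w, covers r w u = covers r w v) -> r z u -> r z v.
  move=> uv /covers_below[w]; rewrite uv => /coversP[rwv _].
  by case/orP=> [/eqP <- //|/r_tr]; apply.
have above u v z : (forall w, covers r u w = covers r v w) -> r u z -> r v z.
  move=> uv /(covers_above r_irr r_tr)[w]; rewrite uv => /coversP[rvw _].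
  by case/orP=> [/eqP <- //|]; apply: r_tr.
move=> px sx z _ _; split; apply/idP/idP; first exact: below.
- by apply: below => w.
- exact: above.
by apply: above => w.
Qed.

(** By twinness any other element above [x] is also above [y], so it neither covers [x] nor lies
    between the two. *)
Lemma twins_succ x y z : twins r x y -> r x y -> covers r x z = (z == y).
Proof.
move=> tw rxy; apply/coversP/eqP => [[rxz h]|->].
  apply/eqP/negPn/negP => zy; apply: (h y rxy).
  have zx : z != x by apply: contraL rxz => /eqP->; rewrite r_irr.
  by have [_ <-] := tw z zx zy.
split=> // w rxw rwy; apply: (lt_asym r_irr r_tr rwy).
have wx : w != x by apply: contraL rxw => /eqP->; rewrite r_irr.
have wy : w != y by apply: contraL rwy => /eqP->; rewrite r_irr.
by have [_ <-] := tw w wx wy.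
Qed.

(** Incomparability and irreflexivity extend the agreement of twins to [x] and [y] themselves, so
    the two are interchangeable in [covers]. *)
Lemma twins_incomparable x y : twins r x y -> ~~ r x y -> ~~ r y x ->
  (forall z, covers r z x = covers r z y) /\
  (forall z, covers r x z = covers r y z).
Proof.
move=> tw nxy nyx.
have e z : r z x = r z y /\ r x z = r y z.
  case: (eqVneq z x) => [->|zx]; first by rewrite r_irr (negPf nxy) (negPf nyx).
  case: (eqVneq z y) => [->|zy]; first by rewrite r_irr (negPf nxy) (negPf nyx).
  exact: tw.
by split=> z; rewrite /covers /=; congr (_ && _); try apply: eq_forallb => w;
  rewrite ?(e w).1 ?(e w).2 ?(e z).1 ?(e z).2.
Qed.

End Rules.

Lemma twins_pred (T : finType) (r : rel T) x y z :
    irreflexive r -> transitive r -> twins r x y -> r x y ->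
  covers r z y = (z == x).
Proof.
move=> irr tr tw rxy; rewrite -(covers_converse r) (@twins_succ _ _ _ _ y x) //.
- by move=> w v u /= a b; apply: tr b a.
- by move=> w wy wx; have [e1 e2] := tw w wx wy; split.
Qed.

(* [r'] is obtained from [r] by contracting the twins [a] and [b] into the
   fresh element [c]; [D] is the field of [r]. *)
Section Contraction.
Variables (T : finType) (D : {set T}) (a b c : T).
Let D0 := D :\: [set a; b].

(** The relations of [c] are read off from [a] alone, since a twin [b] would give the same
    values. *)
Definition contraction (r r' : rel T) : Prop :=
  [/\ forall x y, r x y -> (x \in D) && (y \in D),
      forall x y, r' x y -> (x \in c |: D0) && (y \in c |: D0),
      r' c c = false,
      {in D0 &, r' =2 r} &
      {in D0, forall x, r' c x = r a x /\ r' x c = r x a}].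

Lemma contraction_converse r r' :
  contraction r r' -> contraction (converse r) (converse r').
Proof.
case=> h1 h2 h3 h4 h5; split=> //=.
- by move=> x y /h1; rewrite andbC.
- by move=> x y /h2; rewrite andbC.
- by move=> x y xD yD /=; apply: h4.
by move=> x /h5[].
Qed.

Variables (r r' : rel T).
Hypotheses (r_irr : irreflexive r) (r_tr : transitive r) (tw : twins r a b).
Hypotheses (ctr : contraction r r').

Let in_D0 x : (x \in D0) = [&& x != a, x != b & x \in D].
Proof. by rewrite !inE negb_or andbA. Qed.

Let tw0 x : x \in D0 -> r x a = r x b /\ r a x = r b x.
Proof. by rewrite in_D0 => /and3P[xa xb _]; apply: tw. Qed.

(** An intermediate [a] or [b] in [r] can be traded for [c] in [r'], and [c] for [a]. *)
Lemma covers_contraction_inner x y : x \in D0 -> y \in D0 ->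
  covers r' x y = covers r x y.
Proof.
case: ctr => rD r'D r'c r'E r'cE xD yD.
apply/coversP/coversP => -[xy h]; move: xy; rewrite r'E // => xy; split=> // z xz zy.
- have /andP[_ zD] := rD _ _ xz.
  have nac : r x a -> r a y -> False.
    by move=> xa ay; apply: (h c); [rewrite (r'cE x xD).2|rewrite (r'cE y yD).1].
  have [za|za] := eqVneq z a; first by subst z; apply: nac.
  have [zb|zb] := eqVneq z b.
    by subst z; apply: nac; [rewrite (tw0 xD).1|rewrite (tw0 yD).2].
  have z0 : z \in D0 by rewrite in_D0 za zb.
  by apply: (h z); rewrite r'E.
have /andP[_] := r'D _ _ xz; rewrite in_setU1 => /orP[/eqP zc|z0].
  by subst z; apply: (h a); rewrite -?(r'cE x xD).2 -?(r'cE y yD).1.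
by apply: (h z); rewrite -r'E.
Qed.

(** The upper covers of [c] are those of the larger twin if [a] and [b] are comparable, and those of
    both otherwise; the disjunction fits every case. *)
Lemma covers_contraction_out y : y \in D0 ->
  covers r' c y = covers r a y || covers r b y.
Proof.
case: ctr => rD r'D r'c r'E r'cE yD.
have [r'cy _] := r'cE y yD; have [_ aby] := tw0 yD.
apply/coversP/idP => [[cy h]|].
  have ay : r a y by rewrite -r'cy.
  have h0 z : z \in D0 -> r a z -> r z y -> False.
    by move=> z0 az zy; apply: (h z); [rewrite (r'cE z z0).1|rewrite r'E].
  (* If [a] is below [b], then [b] separates [a] from [y], so the cover must start at [b]. Otherwise
     an element between [a] and [y] is neither twin, hence lies in [D0]. *)
  case rab: (r a b); last first.
    apply/orP; left; apply/coversP; split=> // z az zy.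
    apply: (h0 z) => //; rewrite in_D0 (andP (rD _ _ az)).2 andbT.
    by apply/andP; split; apply/eqP => e; move: az; rewrite e ?r_irr ?rab.
  apply/orP; right; apply/coversP; split=> [|z bz zy]; first by rewrite -aby.
  have z0 : z \in D0.
    rewrite in_D0 (andP (rD _ _ bz)).2 andbT.
    apply/andP; split; apply/eqP => e; move: bz; rewrite e ?r_irr //.
    exact: lt_asym rab.
  by apply: (h0 z) => //; rewrite (tw0 z0).2.
move=> cov; have [e [ey eh eE]] : exists e, [/\ r e y,
    forall z, r e z -> r z y -> False & forall z, z \in D0 -> r a z = r e z].
  case/orP: cov => /coversP[ey eh]; first by exists a.
  by exists b; split=> // z /tw0[].
split; first by rewrite r'cy eE.
move=> z cz zy; have /andP[_] := r'D _ _ cz.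
rewrite in_setU1 => /orP[/eqP zc|z0]; first by rewrite zc r'c in cz.
apply: (eh z); last by rewrite -r'E.
by rewrite -eE // -(r'cE z z0).1.
Qed.

End Contraction.

Lemma covers_contraction_in (T : finType) (D : {set T}) (a b c : T)
    (r r' : rel T) y :
    irreflexive r -> transitive r -> twins r a b -> contraction D a b c r r' ->
    y \in D :\: [set a; b] ->
  covers r' y c = covers r y a || covers r y b.
Proof.
move=> irr tr tw ctr yD; rewrite -!(covers_converse r) -(covers_converse r').
apply: (@covers_contraction_out _ D a b c) => //.
- by move=> w v u /= vw wu; apply: tr wu vw.
- exact: twins_converse.
- exact: contraction_converse.
Qed.

(** * Diagrams of quotients by modular partitions *)

Section Blocks.
Variables (V : finType) (lt : rel V).
Hypotheses (lt_irr : irreflexive lt) (lt_tr : transitive lt).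
Implicit Types (P : {set {set V}}) (A B C : {set V}).

Definition homogeneous A : Prop := forall x y z,
  x \notin A -> y \in A -> z \in A -> lt x y = lt x z /\ lt y x = lt z x.

Definition modular_partition P : Prop :=
  partition P setT /\ {in P, forall A, homogeneous A}.

(** The quotient order. The guards leave sets outside [P] unrelated to everything, so that the
    results on orders over a whole type apply. *)
Definition below P : rel {set V} :=
  [rel A B | [&& A \in P, B \in P, A != B &
    [exists x in A, exists y in B, lt x y]]].

Section Fixed.
Variable P : {set {set V}}.
Hypothesis mP : modular_partition P.

Lemma block_nonempty A : A \in P -> exists x, x \in A.
Proof.
case: mP => /and3P[_ _ n0] _ AP; apply/set0Pn.
by apply: contraNneq n0 => <-.
Qed.

Lemma block_cover x : exists2 A, A \in P & x \in A.
Proof.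
case: mP => /and3P[/eqP cv _ _] _.
by have : x \in finset.cover P by [rewrite cv inE]; case/bigcupP=> A; exists A.
Qed.

Lemma block_eq A B x : A \in P -> B \in P -> x \in A -> x \in B -> A = B.
Proof.
case: mP => /and3P[_ tP _] _ AP BP xA xB.
by rewrite -(def_pblock tP AP xA) (def_pblock tP BP xB).
Qed.

(** Homogeneity of [A], then of [B], carries any witnessing pair to the given representatives. *)
Lemma belowE A B x y : A \in P -> B \in P -> A != B -> x \in A -> y \in B ->
  below P A B = lt x y.
Proof.
move=> AP BP AB xA yB; rewrite /below /= AP BP AB /=.
have hA := mP.2 A AP; have hB := mP.2 B BP.
have nB u : u \in A -> u \notin B.
  by move=> uA; apply: contraNN AB => uB; rewrite (block_eq AP BP uA uB).
have nA u : u \in B -> u \notin A by apply: contraL => /nB.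
apply/'exists_in_exists_inP/idP => [[u uA [v vB uv]]|xy].
  by rewrite (hA y x u (nA y yB) xA uA).2 (hB u y v (nB u uA) yB vB).1.
by exists x => //; exists y.
Qed.

Lemma below_irr : irreflexive (below P).
Proof. by move=> A; rewrite /below /= eqxx !andbF. Qed.

Lemma below_tr : transitive (below P).
Proof.
move=> B A C AB BC.
have /and4P[AP BP nAB _] := AB; have /and4P[_ CP nBC _] := BC.
have [[x xA] [[y yB] [z zC]]] :=
  (block_nonempty AP, (block_nonempty BP, block_nonempty CP)).
move: AB BC; rewrite (belowE _ _ _ xA yB) // (belowE _ _ _ yB zC) // => xy yz.
(* Since [below] demands distinct blocks, [A = C] has to be refuted: it would put [y] and [z] below
   each other. *)
have [AC|AC] := eqVneq A C; last by rewrite (belowE _ _ _ xA zC) // (lt_tr xy yz).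
subst C; have : below P A B by rewrite (belowE _ _ _ xA yB).
rewrite (belowE _ _ _ zC yB) // => zy.
by have := lt_tr yz zy; rewrite lt_irr.
Qed.

Variables a b : {set V}.
Hypotheses (aP : a \in P) (bP : b \in P) (ab : a != b) (tw : twins (below P) a b).
Let P' := (a :|: b) |: (P :\: [set a; b]).

Lemma merged_fresh : a :|: b \notin P.
Proof.
apply/negP=> cP; have [x xa] := block_nonempty aP; have [y yb] := block_nonempty bP.
case/eqP: ab; rewrite (block_eq aP cP xa) ?inE ?xa //.
by rewrite -(block_eq bP cP yb) ?inE ?yb ?orbT.
Qed.

Lemma merged_partition : modular_partition P'.
Proof.
have inP' C : C \in P -> C != a -> C != b -> C \in P'.
  by move=> CP Ca Cb; rewrite !inE negb_or Ca Cb CP orbT.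
have oldP C : C \in P :\: [set a; b] -> [/\ C \in P, C != a & C != b].
  by rewrite !inE negb_or => /andP[/andP[]].
have disj C x : C \in P :\: [set a; b] -> x \in C -> x \notin a :|: b.
  case/oldP=> CP Ca Cb xC; rewrite inE; apply/norP; split.
    by apply: contraNN Ca => xa; rewrite (block_eq CP aP xC xa).
  by apply: contraNN Cb => xb; rewrite (block_eq CP bP xC xb).
split.
  apply/and3P; split.
  - rewrite eqEsubset subsetT; apply/subsetP=> x _.
    have [A AP xA] := block_cover x; apply/bigcupP.
    have [eA|Aa] := eqVneq A a.
      by exists (a :|: b); rewrite ?setU11 // inE -eA xA.
    have [eA|Ab] := eqVneq A b.
      by exists (a :|: b); rewrite ?setU11 // inE -eA xA orbT.
    by exists A => //; apply: inP'.
  - apply/trivIsetP => A B; rewrite !(in_setU1 _ (a :|: b)) => /orP[/eqP->|Ao] /orP[/eqP->|Bo].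
    + by rewrite eqxx.
    + by move=> _; rewrite disjoint_sym disjoint_subset; apply/subsetP=> x /(disj _ _ Bo).
    + by move=> _; rewrite disjoint_subset; apply/subsetP=> x /(disj _ _ Ao).
    + have [[AP _ _] [BP _ _]] := (oldP _ Ao, oldP _ Bo).
      move=> AB; rewrite disjoint_subset; apply/subsetP=> x xA.
      by apply: contraNN AB => xB; rewrite (block_eq AP BP xA xB).
  - apply/negP; rewrite in_setU1 => /orP[/eqP e|/oldP[p0 _ _]].
      by have [x xa] := block_nonempty aP; have := in_set0 x; rewrite e inE xa.
    by have [x] := block_nonempty p0; rewrite inE.
move=> A; rewrite in_setU1 => /orP[/eqP->|/oldP[AP _ _]]; last exact: mP.2.
(* The one new case in the homogeneity of [a :|: b]: twinness of the blocks, read on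
   representatives. *)
have key x y z : x \notin a :|: b -> y \in a -> z \in b ->
    lt x y = lt x z /\ lt y x = lt z x.
  rewrite inE negb_or => /andP[xa xb] ya zb; have [C CP xC] := block_cover x.
  have Ca : C != a by apply: contraNneq xa => <-.
  have Cb : C != b by apply: contraNneq xb => <-.
  have [e1 e2] := tw Ca Cb; move: e1 e2.
  by rewrite !(belowE _ _ _ xC ya) ?(belowE _ _ _ xC zb) //
    (belowE aP CP _ ya xC) 1?(belowE bP CP _ zb xC) 1?eq_sym.
move=> x y z nx; have := nx; rewrite inE negb_or => /andP[xa xb].
rewrite !inE => /orP[ya|yb] /orP[za|zb].
- exact: (mP.2 a aP).
- exact: key.
- by have [-> ->] := key x z y nx za yb.
- exact: (mP.2 b bP).
Qed.

End Fixed.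

(** Lets the results on covers after contracting twins be applied to the merging of two blocks. *)
Lemma merged_contraction P a b : modular_partition P -> a \in P -> b \in P ->
    a != b -> twins (below P) a b ->
  contraction P a b (a :|: b) (below P) (below ((a :|: b) |: (P :\: [set a; b]))).
Proof.
move=> mP aP bP ab tw; have mP' := merged_partition mP aP bP tw.
have fr := merged_fresh mP aP bP ab.
have oldP C : C \in P :\: [set a; b] -> [/\ C \in P, C != a & C != b].
  by rewrite !inE negb_or => /andP[/andP[]].
split.
- by move=> A B /and4P[-> ->].
- by move=> A B /and4P[-> ->].
- exact: below_irr.
- move=> A B Ao Bo; have [[AP _ _] [BP _ _]] := (oldP _ Ao, oldP _ Bo).
  by rewrite /below /= !in_setU1 Ao Bo !orbT AP BP.
move=> C Co; have [CP Ca Cb] := oldP _ Co.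
have Cc : C != a :|: b by apply: contraNneq fr => <-.
have CP' : C \in (a :|: b) |: (P :\: [set a; b]) by rewrite in_setU1 Co orbT.
have cP' : a :|: b \in (a :|: b) |: (P :\: [set a; b]) by rewrite setU11.
have [x xa] := block_nonempty mP aP; have [y yC] := block_nonempty mP CP.
have xc : x \in a :|: b by rewrite inE xa.
split.
  by rewrite (belowE mP' cP' CP' _ xc yC) 1?eq_sym // (belowE mP aP CP _ xa yC) // eq_sym.
by rewrite (belowE mP' CP' cP' _ yC xc) // (belowE mP CP aP _ yC xa).
Qed.

(** The invariant of the reduction. *)
Definition quotient_diagram (H : digraph {set V}) : Prop :=
  modular_partition (vset H) /\
  {in vset H &, Defs.arc H =2 covers (below (vset H))}.

Section Diagram.
Variable H : digraph {set V}.
Hypothesis qH : quotient_diagram H.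

Lemma in_succs A B : A \in vset H -> (B \in succs H A) = covers (below (vset H)) A B.
Proof.
move=> AH; rewrite inE; case BH: (B \in vset H); first by rewrite qH.2.
by rewrite /covers /below /= BH andbF.
Qed.

Lemma in_preds A B : B \in vset H -> (A \in preds H B) = covers (below (vset H)) A B.
Proof.
move=> BH; rewrite inE; case AH: (A \in vset H); first by rewrite qH.2.
by rewrite /covers /below /= AH.
Qed.

Lemma applicable_twins a b : applicable H a b -> twins (below (vset H)) a b.
Proof.
case/and4P=> aH bH ab rule.
have irr := @below_irr (vset H); have tr := below_tr qH.1.
case/orP: rule => /andP[/eqP e1 /eqP e2].
  apply: sequential_twins => // z.
    by rewrite -in_succs // e1 in_set1.
  by rewrite -in_preds // e2 in_set1.
apply: parallel_twins => // z.
  by rewrite -!in_preds // e1.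
by rewrite -!in_succs // e2.
Qed.

(** Comparable twins satisfy the sequential rule with the lower one first, which is why both orders
    appear; incomparable twins satisfy the parallel rule. *)
Lemma twins_applicable a b : a \in vset H -> b \in vset H -> a != b ->
  twins (below (vset H)) a b -> applicable H a b || applicable H b a.
Proof.
move=> aH bH ab tw; rewrite /applicable aH bH ab (eq_sym b) ab /=.
have irr := @below_irr (vset H); have tr := below_tr qH.1.
have seqE x y : x \in vset H -> y \in vset H -> twins (below (vset H)) x y ->
    below (vset H) x y -> sequential H x y.
  move=> xH yH txy xy; apply/andP; split; apply/eqP/setP=> z; rewrite !in_set1.
    by rewrite in_succs // (twins_succ irr tr _ txy).
  by rewrite in_preds // (twins_pred _ irr tr txy).
case lab: (below (vset H) a b); first by rewrite seqE.
case lba: (below (vset H) b a).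
  by rewrite (seqE b a) ?orbT // => z zb za; have [-> ->] := tw z za zb.
have [//| |p s] := twins_incomparable irr tw; rewrite ?lab ?lba //.
have -> : parallel H a b; last by rewrite orbT.
by apply/andP; split; apply/eqP/setP=> z; rewrite ?in_preds ?in_succs.
Qed.

(** The unions of successors and of predecessors in [merge] are exactly the disjunctions describing
    the covers of a contracted pair. *)
Lemma quotient_diagram_merge a b : applicable H a b -> quotient_diagram (Defs.merge H a b).
Proof.
move=> app; have tw := applicable_twins app; case/and4P: app => aH bH ab _.
have irr := @below_irr (vset H); have tr := below_tr qH.1.
have ctr := merged_contraction qH.1 aH bH ab tw.
have fr := merged_fresh qH.1 aH bH ab.
split; first exact: (merged_partition qH.1 aH bH tw).
move=> A B /=; rewrite !(in_setU1 _ (a :|: b)).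
have old C : C \in vset H :\: [set a; b] -> (C \in vset H) && (C != a :|: b).
  by rewrite inE => /andP[_ CH]; rewrite CH; apply: contraNneq fr => <-.
have inD (X : {set {set V}}) C : C \in vset H :\: [set a; b] ->
    (C \in X :\: [set a; b]) = (C \in X).
  by rewrite in_setD => /andP[nC _]; rewrite in_setD nC.
case/orP=> [/eqP->|Ao] /orP[/eqP->|Bo].
- by rewrite eqxx /covers /below /= eqxx !andbF.
- have /andP[BH Bc] := old B Bo.
  rewrite eqxx Bc inD // in_setU !in_succs //.
  by rewrite (covers_contraction_out irr tr tw ctr).
- have /andP[AH Ac] := old A Ao.
  rewrite (negPf Ac) eqxx inD // in_setU !in_preds //.
  by rewrite (covers_contraction_in irr tr tw ctr).
have [/andP[AH Ac] /andP[BH Bc]] := (old A Ao, old B Bo).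
rewrite (negPf Ac) (negPf Bc) qH.2 //.
by rewrite (covers_contraction_inner tw ctr).
Qed.

End Diagram.

Lemma quotient_diagram_reduces H R :
  reduces_to H R -> quotient_diagram H -> quotient_diagram R.
Proof.
by elim=> // K a b K' app _ IH qK; apply: IH; apply: quotient_diagram_merge.
Qed.

End Blocks.

(** * Series-parallel sets and prime-free modules *)

Section Splitting.
Variables (T : finType) (r : rel T).
Hypotheses (r_irr : irreflexive r) (r_tr : transitive r).
Implicit Types A B C N S : {set T}.

Definition cut A B : Prop :=
  [\/ {in A & B, forall x y, ~~ r x y /\ ~~ r y x},
      {in A & B, forall x y, r x y} | {in A & B, forall x y, r y x}].

(* Quantifying over all subsets makes the notion hereditary by construction. *)
Definition series_parallel S : Prop :=
  forall U : {set T}, U \subset S -> 1 < #|U| ->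
    exists A, [/\ A != set0, A \proper U & cut A (U :\: A)].

Lemma cut_const A B : cut A B ->
  {in A & B, forall x y, {in A & B, forall x' y', r x y = r x' y' /\ r y x = r y' x'}}.
Proof.
move=> [] h x y xA yB x' y' xA' yB'; have h1 := h x y xA yB; have h2 := h x' y' xA' yB'.
- by case: h1 h2 => [/negPf -> /negPf ->] [/negPf -> /negPf ->].
- have n u v : r u v -> r v u = false.
    by move=> uv; apply/negP; apply: lt_asym uv.
  by rewrite h1 h2 (n _ _ h1) (n _ _ h2).
have n u v : r u v -> r v u = false.
  by move=> uv; apply/negP; apply: lt_asym uv.
by rewrite h1 h2 (n _ _ h1) (n _ _ h2).
Qed.

(** A single pair of representatives decides the kind of cut; an empty side is trivial. *)
Lemma const_cut A B :
    {in A & B, forall x y, {in A & B, forall x' y', r x y = r x' y' /\ r y x = r y' x'}} ->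
  cut A B.
Proof.
move=> h; have [->|[x xA]] := set_0Vmem A; first by constructor 1 => x y; rewrite inE.
have [->|[y yB]] := set_0Vmem B; first by constructor 1 => u v _; rewrite inE.
case xy: (r x y); first by constructor 2 => u v uA vB; have [<- _] := h x y xA yB u v uA vB.
case yx: (r y x); first by constructor 3 => u v uA vB; have [_ <-] := h x y xA yB u v uA vB.
by constructor 1 => u v uA vB; have [<- <-] := h x y xA yB u v uA vB; rewrite xy yx.
Qed.

Lemma cutS A B A' B' : A' \subset A -> B' \subset B -> cut A B -> cut A' B'.
Proof.
move=> /subsetP sA /subsetP sB; case=> h; [constructor 1|constructor 2|constructor 3];
  by move=> x y /sA xA /sB yB; apply: h.
Qed.

(** A subset lying in neither part meets both, and is split by its trace on [A]. *)
Lemma series_parallel_join A B :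
  series_parallel A -> series_parallel B -> cut A B -> series_parallel (A :|: B).
Proof.
move=> hA hB cAB U sU cU.
have [sUA|nUA] := boolP (U \subset A); first exact: hA.
have [sUB|nUB] := boolP (U \subset B); first exact: hB.
exists (U :&: A); split.
- case/subsetPn: nUB => x xU xB; apply/set0Pn; exists x.
  by have := subsetP sU x xU; rewrite !inE xU (negPf xB) orbF.
- by rewrite properEneq subsetIl andbT; apply: contraNneq nUA => <-; rewrite subsetIr.
apply: cutS cAB; first exact: subsetIr.
apply/subsetP=> x; rewrite !inE => /andP[nx xU].
by have := subsetP sU x xU; rewrite inE; move: nx; rewrite xU /= => /negPf->.
Qed.

(** Induction on the size of [S]: twins of one side of a cut remain twins in [S], because each point
    of the other side sees that side uniformly. *)
Lemma series_parallel_twins S : series_parallel S -> 1 < #|S| ->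
  exists x y, [/\ x \in S, y \in S, x != y &
    {in S, forall z, z != x -> z != y -> r z x = r z y /\ r x z = r y z}].
Proof.
have [n] := ubnP #|S|; elim: n => // n IH in S * => ltS hS cS.
have [A [nA pA cA]] := hS S (subxx _) cS; have sA := proper_sub pA.
have sub (U : {set T}) : U \subset S -> series_parallel U.
  by move=> sU W sW; apply: hS; apply: subset_trans sW sU.
have step (U : {set T}) : U \proper S -> 1 < #|U| ->
    (forall x y z, x \in U -> y \in U -> z \in S -> z \notin U ->
      r z x = r z y /\ r x z = r y z) ->
    exists x y, [/\ x \in S, y \in S, x != y &
      {in S, forall z, z != x -> z != y -> r z x = r z y /\ r x z = r y z}].
  move=> pU cU h; have sU := proper_sub pU.
  have [|x [y [xU yU xy tw]]] := IH U _ (sub U sU) cU.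
    exact: leq_trans (proper_card pU) ltS.
  exists x, y; rewrite !(subsetP sU) //; split=> // z zS zx zy.
  by have [zU|zU] := boolP (z \in U); [apply: tw|apply: h].
have [cA1|cA1] := ltnP 1 #|A|.
  apply: step pA cA1 _ => x y z xA yA zS zA.
  have zD : z \in S :\: A by rewrite inE zA.
  by have [-> ->] := cut_const cA xA zD yA zD.
have [cB1|cB1] := ltnP 1 #|S :\: A|.
  apply: step cB1 _ => [|x y z].
    rewrite properEneq subsetDl andbT; apply: contraNneq nA => e.
    by rewrite -(setIidPr sA) -e setIDAC setDIl setDv setI0.
  rewrite !inE => /andP[xA xS] /andP[yA yS] zS; rewrite zS andbT negbK => zA.
  have xD : x \in S :\: A by rewrite inE xA.
  have yD : y \in S :\: A by rewrite inE yA.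
  by have [-> ->] := cut_const cA zA xD zA yD.
(* Both sides are singletons, so [S] is a pair and no third point can tell its elements apart. *)
have [x eA] : exists x, A = [set x].
  by apply/cards1P; rewrite eqn_leq cA1 card_gt0.
have [y eB] : exists y, S :\: A = [set y].
  apply/cards1P; rewrite eqn_leq cB1 card_gt0 /=.
  by rewrite setD_eq0; case/properP: pA => _ [y yS yA]; apply/subsetPn; exists y.
have yD : y \in S :\: A by rewrite eB set11.
move: (yD); rewrite inE eA in_set1 => /andP[yx yS].
exists x, y; split=> //; first by rewrite (subsetP sA) // eA set11.
  by rewrite eq_sym.
move=> z zS zx zy; have : z \in S :\: A by rewrite inE eA in_set1 zx.
by rewrite eB in_set1 (negPf zy).
Qed.

End Splitting.

(** * Modules of a strict order and the decomposition tree *)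

Section PrimeFree.
Variables (T : finType) (H : digraph T).
Local Notation r := (Defs.arc H).
Hypotheses (r_irr : irreflexive r) (r_tr : transitive r).
Implicit Types A B C N S : {set T}.

Lemma moduleP A : reflect
  [/\ A != set0, A \subset vset H & forall x y z, x \in vset H -> x \notin A ->
     y \in A -> z \in A -> r x y = r x z /\ r y x = r z x]
  (is_module H A).
Proof.
apply: (iffP and3P) => -[n0 sA h]; split=> //.
  move=> x y z xH xA yA zA; have /forall_inP/(_ x) := h; rewrite inE xA xH.
  by move=> /(_ isT)/forall_inP/(_ y yA)/forall_inP/(_ z zA)/andP[/eqP-> /eqP->].
apply/forall_inP=> x; rewrite inE => /andP[xA xH].
apply/forall_inP=> y yA; apply/forall_inP=> z zA.
by have [e1 e2] := h x y z xH xA yA zA; rewrite e1 e2 !eqxx.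
Qed.

Lemma module_disjoint_const A B : is_module H A -> is_module H B -> [disjoint A & B] ->
  {in A & B, forall x y, {in A & B, forall x' y', r x y = r x' y' /\ r y x = r y' x'}}.
Proof.
move=> /moduleP[_ sA hA] /moduleP[_ sB hB] dAB x y xA yB x' y' xA' yB'.
have yA : y \notin A by rewrite (disjointFl dAB yB).
have xB : x' \notin B by rewrite (disjointFr dAB xA').
have [-> ->] := hA y x x' (subsetP sB y yB) yA xA xA'.
by have [-> ->] := hB x' y y' (subsetP sA x' xA') xB yB yB'.
Qed.

Lemma module_union A B : is_module H A -> is_module H B -> A :&: B != set0 ->
  is_module H (A :|: B).
Proof.
move=> /moduleP[nA sA hA] /moduleP[_ sB hB] /set0Pn[w]; rewrite inE => /andP[wA wB].
apply/moduleP; split; first by apply/set0Pn; exists w; rewrite inE wA.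
  by rewrite subUset sA.
move=> x y z xH; rewrite !in_setU negb_or => /andP[xA xB].
have e u : (u \in A) || (u \in B) -> r x u = r x w /\ r u x = r w x.
  by case/orP=> uX; [apply: hA|apply: hB].
by move=> /e[-> ->] /e[-> ->].
Qed.

Lemma module_inter A B : is_module H A -> is_module H B -> A :&: B != set0 ->
  is_module H (A :&: B).
Proof.
move=> /moduleP[_ sA hA] /moduleP[_ _ hB] n0; apply/moduleP; split=> //.
  exact: subset_trans (subsetIl _ _) sA.
move=> x y z xH; rewrite !in_setI negb_and => nx /andP[yA yB] /andP[zA zB].
by case/orP: nx => nx; [apply: hA|apply: hB].
Qed.

(* For [x] in [A :\: B] and [y] in [B], the relation of [x] to [B] is constant,
   and that of any point of [B :\: A] to [A] is constant as well. *)
Lemma overlap_cut A B : is_module H A -> is_module H B -> overlap A B ->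
  cut r (A :\: B) B.
Proof.
move=> /moduleP[_ sA hA] /moduleP[_ sB hB] /and3P[_ _ /subsetPn[w wB wA]].
apply: const_cut => // x y; rewrite inE => /andP[xB xA] yB x' y'.
rewrite inE => /andP[xB' xA'] yB'.
have [-> ->] := hB x y w (subsetP sA x xA) xB yB wB.
have [-> ->] := hB x' y' w (subsetP sA x' xA') xB' yB' wB.
by have [-> ->] := hA w x x' (subsetP sB w wB) wA xA xA'.
Qed.

Lemma module_setD_cut A C : is_module H A -> C \subset A -> A :\: C != set0 ->
  cut r C (A :\: C) -> is_module H (A :\: C).
Proof.
move=> /moduleP[_ sA hA] sC n0 cC; apply/moduleP; split=> //.
  exact: subset_trans (subsetDl _ _) sA.
move=> x y z xH nx yD zD; have [xA|xA] := boolP (x \in A); last first.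
  by apply: hA => //; [move: yD|move: zD]; rewrite inE => /andP[].
have xC : x \in C by move: nx; rewrite inE xA andbT negbK.
by have [-> ->] := cut_const r_irr r_tr cC xC yD xC zD.
Qed.

(** Points outside [A] see it uniformly as [A] is a module; points of [A] inside [B] see [A :\: B]
    uniformly by [overlap_cut]. *)
Lemma module_setD A B : is_module H A -> is_module H B -> overlap A B ->
  is_module H (A :\: B).
Proof.
move=> mA mB ov; have /and3P[_ nAB _] := ov.
have n0 : A :\: B != set0 by rewrite setD_eq0.
have [_ sA hA] := moduleP _ mA; have [_ sB hB] := moduleP _ mB.
apply/moduleP; split=> //; first exact: subset_trans (subsetDl _ _) sA.
move=> x y z xH nx yD zD; have [xA|xA] := boolP (x \in A); last first.
  by apply: hA => //; [move: yD|move: zD]; rewrite inE => /andP[].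
have xB : x \in B by move: nx; rewrite inE xA andbT negbK.
by have [-> ->] := cut_const r_irr r_tr (overlap_cut mA mB ov) yD xB zD xB.
Qed.

Lemma childP N C : reflect
  [/\ strong_module H C, C \proper N &
      forall B, strong_module H B -> B \proper N -> C \subset B -> B = C]
  (C \in children H N).
Proof.
rewrite inE; apply: (iffP maxsetP) => /= [[/andP[sC pC] h]|[sC pC h]].
  by split=> // B sB pB; apply: h; rewrite sB.
by split=> [|B /andP[sB pB]]; [rewrite sC|apply: h].
Qed.

Lemma strong_sub_child N B : strong_module H B -> B \proper N ->
  exists2 C, C \in children H N & B \subset C.
Proof.
move=> sB pB; have [|C mC sBC] := @maxset_exists _
  [pred B | strong_module H B && (B \proper N)] B; first by rewrite /= sB.
by exists C; rewrite ?inE.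
Qed.

(** Singletons are strong modules, and are proper in [N] once it has two points. *)
Lemma child_cover N x : N \subset vset H -> 1 < #|N| -> x \in N ->
  exists2 C, C \in children H N & x \in C.
Proof.
move=> sN cN xN; have [||C cC] := @strong_sub_child N [set x].
- apply/andP; split; first apply/moduleP; first split.
  + by apply/set0Pn; exists x; rewrite set11.
  + by rewrite sub1set (subsetP sN).
  + by move=> u v w _ _; rewrite !in_set1 => /eqP-> /eqP->.
  apply/forall_inP=> B _; rewrite /overlap !negb_and !negbK sub1set.
  have [_|xB] := boolP (x \in B); first by rewrite orbT.
  rewrite (_ : _ == _) //; apply/eqP/setP=> z; rewrite !inE.
  by case: eqP => // ->; rewrite (negPf xB).
- rewrite properEneq sub1set xN andbT; apply: contraTneq cN => <-.
  by rewrite cards1.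
by rewrite sub1set; exists C.
Qed.

(** Strong modules that meet are nested, and maximality turns nesting into equality. *)
Lemma children_disjoint N C D : C \in children H N -> D \in children H N -> C != D ->
  [disjoint C & D].
Proof.
move=> /childP[sC pC hC] /childP[sD pD hD] CD; rewrite -setI_eq0.
apply: contraNT CD => n0; have /andP[_ /forall_inP/(_ D)] := sC.
have /andP[mD _] := sD; move=> /(_ mD); rewrite /overlap n0 /= -negb_or negbK.
by case/orP=> s; [rewrite (hC D)|rewrite (hD C)].
Qed.

(** Strong induction on the size of [N]: it suffices to write [N] as two smaller modules separated
    by a cut. A failure of strongness, or any of the four ways in which the node is not prime, is
    exploited in turn. *)
Lemma prime_free_series_parallel N :
  prime_free H -> is_module H N -> series_parallel r N.
Proof.
move=> pf; have [n] := ubnP #|N|; elim: n => // n IH in N * => ltN mN.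
have [cN U sU|cN] := leqP #|N| 1.
  by rewrite ltnNge (leq_trans (subset_leq_card sU)).
suff [A [B [pA pB mA mB [eN cAB]]]] : exists A B, [/\ A \proper N, B \proper N,
    is_module H A, is_module H B & N = A :|: B /\ cut r A B].
  rewrite eN; apply: series_parallel_join cAB; apply: IH => //;
  exact: leq_trans (proper_card _) ltN.
have [n0 sN hN] := moduleP _ mN.
(* Two overlapping modules covering [N] are made disjoint by replacing [A] with [A :\: B]. *)
have split_ov A B : is_module H A -> is_module H B -> overlap A B -> N = A :|: B ->
    exists A B, [/\ A \proper N, B \proper N,
    is_module H A, is_module H B & N = A :|: B /\ cut r A B].
  move=> mA mB ov eN; exists (A :\: B), B.
  have /and3P[/set0Pn[w]] := ov; rewrite inE => /andP[wA wB] nAB nBA.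
  split=> //; last 1 first.
  - split; last exact: overlap_cut.
    by rewrite eN; apply/setP=> z; rewrite !inE; case: (z \in B); rewrite ?orbT ?orbF.
  - apply/properP; split; last by exists w; rewrite ?eN !inE ?wA ?wB.
    by rewrite eN; apply: subset_trans (subsetDl _ _) (subsetUl _ _).
  - rewrite properEneq eN subsetUr andbT; apply: contraNneq nAB => ->.
    exact: subsetUl.
  - exact: module_setD.
have [strN|] := boolP (strong_module H N); last first.
  rewrite /strong_module mN /= => /forall_inPn[B mB /negPn ov].
  have /and3P[nI nNB nBN] := ov.
  have dI : (N :\: B) :|: (N :&: B) = N by rewrite setUC setID.
  exists (N :\: B), (N :&: B); split.
  - rewrite properEneq subsetDl andbT; apply: contraNneq nI => e.
    by rewrite setI_eq0; apply/setDidPl.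
  - by rewrite properEneq subsetIl andbT; apply: contraNneq nNB => <-; rewrite subsetIr.
  - exact: module_setD.
  - exact: module_inter.
  - by split=> //; apply: cutS (overlap_cut mN mB ov); rewrite ?subsetIr.
have split_child C : C \in children H N -> cut r C (N :\: C) ->
    exists A B, [/\ A \proper N, B \proper N,
    is_module H A, is_module H B & N = A :|: B /\ cut r A B].
  move=> /childP[/andP[mC _] pC _] cC; exists C, (N :\: C); split=> //.
  - have [/set0Pn[w wC] _ _] := moduleP _ mC.
    rewrite properEneq subsetDl andbT; apply/eqP => e.
    by have := subsetP (proper_sub pC) w wC; rewrite -e inE wC.
  - apply: module_setD_cut => //; first exact: proper_sub.
    by rewrite setD_eq0; case/andP: pC.
  - by split=> //; rewrite -{1}(setID N C) (setIidPr (proper_sub pC)).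
have child_of x := @child_cover N x sN cN.
have child_mod C : C \in children H N -> is_module H C.
  by case/childP=> /andP[].
have child_sub C x : C \in children H N -> x \in C -> x \in N.
  by case/childP=> _ /proper_sub/subsetP h _; apply: h.
have arcQ C D x y : C \in children H N -> D \in children H N -> C != D ->
    x \in C -> y \in D -> Defs.arc (child_quotient H N) C D = r x y.
  move=> cC cD CD xC yD; rewrite /= CD /=.
  apply/'exists_in_exists_inP/idP => [[u uC [v vD uv]]|xy]; last by exists x => //; exists y.
  have cst := module_disjoint_const (child_mod C cC) (child_mod D cD)
    (children_disjoint cC cD CD).
  by have [<- _] := cst u v uC vD x y xC yD.
have [x0 x0N] := set0Pn _ n0; have [C0 cC0 x0C] := child_of x0 x0N.
have other C x : x \in N :\: C ->
    exists D, [/\ D \in children H N, D != C & x \in D].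
  rewrite inE => /andP[xC xN]; have [D cD xD] := child_of x xN.
  by exists D; split=> //; apply: contraNneq xC => <-.
have /forallP/(_ N) := pf; rewrite /prime_module strN /= => np.
have chn0 : children H N != set0 by apply/set0Pn; exists C0.
move: np; rewrite chn0 /= !negb_and !negbK => /or4P[triv|compl|edg|tot].
(* A nontrivial module [X] of the quotient: the union [U] of its members is a proper submodule of
   [N]. *)
- case/forallPn: triv => X; rewrite negb_imply negb_or => /and3P[mX XT X1].
  have /and3P[nX sX hX] := mX; rewrite /= in sX XT.
  pose U := \bigcup_(C in X) C.
  have [D0 D0N D0X] : exists2 D, D \in children H N & D \notin X.
    by apply/subsetPn; apply: contraNN XT => s; rewrite eqEsubset sX.
  have pU : U \proper N.
    apply/properP; split.
      by apply/bigcupsP=> C /(subsetP sX)/childP[_ /proper_sub].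
    have [/set0Pn[w wD] _ _] := moduleP _ (child_mod D0 D0N).
    exists w; first exact: child_sub wD.
    apply/bigcupP=> -[C CX wC]; have CN := subsetP sX C CX.
    have CD : C != D0 by apply: contraNneq D0X => <-.
    by have := disjointFr (children_disjoint CN D0N CD) wC; rewrite wD.
  have mU : is_module H U.
    apply/moduleP; split.
    - have [C CX] := set0Pn _ nX.
      have [/set0Pn[w wC] _ _] := moduleP _ (child_mod C (subsetP sX C CX)).
      by apply/set0Pn; exists w; apply/bigcupP; exists C.
    - exact: subset_trans (proper_sub pU) sN.
    move=> x y z xH xU yU zU; have [xN|xN] := boolP (x \in N); last first.
      by apply: hN => //; apply: (subsetP (proper_sub pU)).
    have [D cD xD] := child_of x xN.
    have DX : D \notin X by apply: contraNN xU => DX; apply/bigcupP; exists D.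
    case/bigcupP: yU => C CX yC; case/bigcupP: zU => C' CX' zC.
    have CN := subsetP sX C CX; have CN' := subsetP sX C' CX'.
    have CD : C != D by apply: contraNneq DX => <-.
    have CD' : C' != D by apply: contraNneq DX => <-.
    have DQ : D \in vset (child_quotient H N) :\: X by rewrite inE DX.
    have := forall_inP hX D DQ.
    move=> /forall_inP/(_ C CX)/forall_inP/(_ C' CX')/andP[/eqP e1 /eqP e2].
    move: e1 e2; rewrite (arcQ D C x y) 1?eq_sym // (arcQ D C' x z) 1?eq_sym //.
    by rewrite (arcQ C D y x) // (arcQ C' D z x).
  (* [U] is enlarged to a maximal proper submodule [A]. If [A] were strong it would fit in one
     child, forcing [X] to be a singleton; so [A] overlaps some [B]. *)
  have [|A /maxsetP[/= /andP[mA pA] hA] sUA] := @maxset_exists _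
    [pred B | is_module H B && (B \proper N)] U; first by rewrite /= mU.
  have [strA|] := boolP (strong_module H A).
    have [D cD sAD] := strong_sub_child strA pA.
    have all_eq C : C \in X -> C = D.
      move=> CX; have CN := subsetP sX C CX; apply/eqP; apply/negPn/negP => CD.
      have [/set0Pn[w wC] _ _] := moduleP _ (child_mod C CN).
      have wD : w \in D.
        by apply: (subsetP sAD); apply: (subsetP sUA); apply/bigcupP; exists C.
      by have := disjointFr (children_disjoint CN cD CD) wC; rewrite wD.
    case/negP: X1; apply/cards1P; exists D; apply/setP=> C; rewrite in_set1.
    apply/idP/eqP => [/all_eq //|->].
    by have [C' CX'] := set0Pn _ nX; rewrite -(all_eq C' CX').
  rewrite /strong_module mA /= => /forall_inPn[B mB /negPn ov].
  have /and3P[/set0Pn[w]] := ov; rewrite inE => /andP[wA wB] nAB nBA.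
  have sAN := proper_sub pA.
  (* [N] is strong, so [B] is nested with it; [N] inside [B] would put [A] inside [B]. *)
  have sBN : B \subset N.
    have /andP[_ /forall_inP/(_ B mB)] := strN; rewrite /overlap.
    have -> /= : N :&: B != set0.
      by apply/set0Pn; exists w; rewrite inE wB (subsetP sAN).
    rewrite negb_and !negbK; case/orP=> // /(subset_trans sAN).
    by rewrite (negPf nAB).
  have mAB : is_module H (A :|: B).
    by apply: module_union => //; apply/set0Pn; exists w; rewrite inE wA.
  (* By maximality of [A], the strictly larger module [A :|: B] must be all of [N]. *)
  apply: (split_ov A B) => //; apply/eqP; rewrite eq_sym; apply/negPn/negP => ne.
  have e : A :|: B = A.
    apply: hA; last exact: subsetUl.
    by rewrite mAB properEneq ne subUset sAN.
  by case/negP: nBA; rewrite -e subsetUr.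
(* A complete quotient has arcs both ways between two children, against asymmetry. *)
- have [/set0Pn[x xD]|] := boolP (N :\: C0 != set0); last first.
    rewrite negbK setD_eq0; have /childP[_ /andP[_ nNC] _] := cC0.
    by rewrite (negPf nNC).
  have [D [cD DC xD']] := other C0 x xD.
  have /forall_inP/(_ C0 cC0)/forall_inP/(_ D cD) := compl.
  have /forall_inP/(_ D cD)/forall_inP/(_ C0 cC0) := compl.
  rewrite DC (eq_sym C0) DC !implyTb.
  rewrite (arcQ D C0 x x0) // (arcQ C0 D x0 x) 1?eq_sym // => a1 a2.
  by case: (lt_asym r_irr r_tr a1 a2).
- apply: (split_child C0) => //; constructor 1 => x y xC yD.
  have [D [cD DC yD']] := other C0 y yD.
  have /forall_inP/(_ C0 cC0)/forall_inP/(_ D cD) := edg.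
  have /forall_inP/(_ D cD)/forall_inP/(_ C0 cC0) := edg.
  by rewrite (arcQ D C0 y x) // (arcQ C0 D x y) 1?eq_sym.
(* The child of a minimal element of [N] is the first one. *)
case: (arg_minnP (fun x => #|[set w in N | r w x]|) x0N) => m mN' mmin.
have mmin' w : w \in N -> ~~ r w m.
  move=> wN; apply/negP=> wm; have := mmin w wN; rewrite leqNgt => /negP; apply.
  apply: proper_card; apply/properP; split; last by exists w; rewrite inE wN ?r_irr.
  by apply/subsetP=> u; rewrite !inE => /andP[-> /r_tr]; apply.
have [C cC mC] := child_of m mN'; apply: (split_child C) => //.
constructor 2 => x y xC yD; have [D [cD DC yD']] := other C y yD.
(* Totality puts exactly one arc between [C] and [D], and minimality of [m] forbids the one into
   [C]. *)
move: tot; rewrite -negb_and negbK => /andP[tot1 _]; have := forall_inP (forall_inP tot1 C cC) D cD.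
rewrite eq_sym (negPf DC) (arcQ C D m y) 1?eq_sym // (arcQ D C y m) //.
rewrite (negPf (mmin' y (child_sub _ _ cD yD'))) addbF.
by rewrite -(arcQ C D m y) 1?eq_sym // (arcQ C D x y) // eq_sym.
Qed.

End PrimeFree.

(** * Reductions of a transitively reduced graph *)

Section Closure.
Variables (V : finType) (E : rel V).
Hypothesis acyclicE : acyclic E.

Lemma acyclic_no_return x z : E x z -> connect E z x -> False.
Proof.
move=> xz /connectP[p]; case/shortenP=> q zq uq _ ex.
suff /acyclicE : ucycle E (z :: q) by [].
by rewrite /ucycle uq andbT /= rcons_path zq -ex.
Qed.

(** One direction is minimality of the closure. In the other, acyclicity supplies the proviso that
    the endpoints differ when arcs are composed. *)
Lemma trans_closureP x y :
  reflect (exists2 z, E x z & connect E z y) (trans_closure E x y).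
Proof.
apply: (iffP idP) => [xy|[z xz zy]].
  pose s := [rel x y | [exists z, E x z && connect E z y]].
  have /existsP[z /andP[xz zy]] : s x y; last by exists z.
  apply: (@trans_closure_min _ E s _ _ x y xy) => [u v uv|a b c].
    by apply/existsP; exists v; rewrite uv connect0.
  move=> /existsP[u /andP[au ub]] /existsP[v /andP[bv vc]] _.
  apply/existsP; exists u; rewrite au /=.
  exact: connect_trans ub (connect_trans (connect1 bv) vc).
case/connectP: zy => p; elim: p x z xz => [|w p IH] x z xz /= => [_ ->|].
  exact: trans_closure_sub.
case/andP=> zw wp ey; have zy := IH z w zw wp ey.
apply: trans_closure_trans (trans_closure_sub xz) zy _.
apply/eqP => xy; apply: (acyclic_no_return xz); apply/connectP.
by exists (w :: p); rewrite /= ?zw // xy.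
Qed.

Lemma trans_closure_irr : irreflexive (trans_closure E).
Proof.
by move=> x; apply/negP=> /trans_closureP[z xz zx]; apply: acyclic_no_return xz zx.
Qed.

Lemma trans_closure_tr : transitive (trans_closure E).
Proof.
move=> y x z /trans_closureP[u xu uy] /trans_closureP[v yv vz].
apply/trans_closureP; exists u => //.
exact: connect_trans uy (connect_trans (connect1 yv) vz).
Qed.

(** A covering pair is joined by a walk that cannot have an inner vertex. Conversely, an element
    between the ends of an arc would yield a path of length at least two beside it. *)
Lemma covers_trans_closure :
  transitively_reduced E -> covers (trans_closure E) =2 E.
Proof.
move=> redE x y; apply/coversP/idP => [[/trans_closureP[z xz zy] h]|xy].
  have [<- //|zny] := eqVneq z y.
  case: (h z); first exact: trans_closure_sub.
  case/connectP: zy => -[|w p] /= => [_ e|/andP[zw wp] e].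
    by rewrite e eqxx in zny.
  by apply/trans_closureP; exists w => //; apply/connectP; exists p.
split=> [|z /trans_closureP[u xu uz] /trans_closureP[v zv vy]].
  exact: trans_closure_sub.
have /connectP[p up ep] := uz; have /connectP[q vq eq] := vy.
have xpq : path E x ((u :: p) ++ v :: q).
  by rewrite cat_path /= xu up -ep zv vq.
(* The walk increases strictly for the closure, so it repeats no vertex. *)
have unq : uniq (x :: (u :: p) ++ v :: q).
  apply: (sorted_uniq trans_closure_tr trans_closure_irr).
  by apply: sub_path xpq; apply: trans_closure_sub.
have := redE x y _ xy xpq unq; rewrite last_cat /= size_cat addnS => /(_ (esym eq)).
by [].
Qed.

Lemma quotient_diagram_initial :
  transitively_reduced E -> quotient_diagram (trans_closure E) (initial E).
Proof.
move=> redE; have inP A : A \in vset (initial E) -> exists x, A = [set x].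
  by case/imsetP=> x _ ->; exists x.
have mP : modular_partition (trans_closure E) (vset (initial E)).
  split; last first.
    by move=> A /inP[w ->] x y z _; rewrite !in_set1 => /eqP-> /eqP->.
  apply/and3P; split.
  - rewrite eqEsubset subsetT; apply/subsetP=> x _; apply/bigcupP.
    by exists [set x]; rewrite ?set11 ?imset_f.
  - apply/trivIsetP=> A B /inP[x ->] /inP[y ->] xy.
    by rewrite disjoints1 in_set1; apply: contraNneq xy => ->.
  - by apply/negP=> /inP[x] /setP/(_ x); rewrite !inE eqxx.
have bE x y : below (trans_closure E) (vset (initial E)) [set x] [set y] =
    trans_closure E x y.
  have [<-|xy] := eqVneq x y; first by rewrite below_irr trans_closure_irr.
  by rewrite (belowE mP _ _ _ (set11 x) (set11 y)) ?imset_f // (inj_eq set1_inj).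
split=> // _ _ /inP[x ->] /inP[y ->].
have -> : Defs.arc (initial E) [set x] [set y] = E x y.
  apply/'exists_existsP/idP => [[u [v /and3P[/eqP/set1_inj-> /eqP/set1_inj-> //]]]|xy].
  by exists x, y; rewrite !eqxx.
rewrite -covers_trans_closure // /covers /= bE; congr (_ && _).
(* Intermediate elements need only be sought among singletons, as [below] relates no other sets
   here. *)
apply/forallP/forallP => h z; last by have := h [set z]; rewrite !bE.
case zI: (z \in vset (initial E)); last by rewrite /below /= zI !andbF.
by have [w ->] := inP z zI; rewrite !bE.
Qed.

End Closure.

(** * Representatives of the blocks meeting a module *)

Section Representatives.
Variables (V : finType) (lt : rel V).
Hypotheses (lt_irr : irreflexive lt) (lt_tr : transitive lt).

Lemma series_parallel_merged (R : digraph {set V}) (M : {set V}) :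
    quotient_diagram lt R -> irreducible R -> M != set0 -> homogeneous lt M ->
    series_parallel lt M ->
  exists2 B : {set V}, B \in vset R & M \subset B.
Proof.
move=> qR irrR /set0Pn[m mM] homM spM; have mP := qR.1.
have [B0 B0R mB0] := block_cover mP m; exists B0 => //.
apply/subsetPn => -[m' m'M m'B0]; have [B1 B1R mB1] := block_cover mP m'.
(* The default [m] is never returned on [X], whose blocks all meet [M]. *)
pose f (A : {set V}) := odflt m [pick x in A :&: M].
pose X := [set A in vset R | A :&: M != set0].
have fA A : A \in X -> [/\ A \in vset R, f A \in A & f A \in M].
  rewrite inE /f => /andP[AR /set0Pn[x xAM]]; case: pickP => [y|/(_ x)] /=.
    by rewrite inE => /andP[].
  by rewrite xAM.
have finj A B : A \in X -> B \in X -> f A = f B -> A = B.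
  by move=> /fA[AR fAA _] /fA[BR fBB _] e; apply: (block_eq mP AR BR fAA); rewrite e.
have inX A x : A \in vset R -> x \in A -> x \in M -> A \in X.
  by move=> AR xA xM; rewrite inE AR; apply/set0Pn; exists x; rewrite inE xA.
have sSM : f @: X \subset M.
  by apply/subsetP=> _ /imsetP[A /fA[_ _ h] ->].
have cS : 1 < #|f @: X|.
  apply/card_gt1P; exists (f B0), (f B1); split.
  - by apply: imset_f; apply: inX mM.
  - by apply: imset_f; apply: inX m'M.
  apply: contraNneq m'B0 => /finj ->; [exact: mB1|exact: inX mM|exact: inX m'M].
have spS : series_parallel lt (f @: X).
  by move=> U sU; apply: spM; apply: subset_trans sU sSM.
have [_ [_ [/imsetP[A AX ->] /imsetP[B BX ->] neq tw]]] :=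
  series_parallel_twins lt_irr lt_tr spS cS.
have AB : A != B by apply: contraNneq neq => ->.
have [[AR fAA fAM] [BR fBB fBM]] := (fA A AX, fA B BX).
suff twAB : twins (below lt (vset R)) A B.
  by case/orP: (twins_applicable lt_irr lt_tr qR AR BR AB twAB); apply/negP.
(* A third block [C] is tested at a single point: its representative if it meets [M], where the
   twins of [f @: X] apply, and otherwise any point, which lies outside the homogeneous set [M]. *)
move=> C CA CB; case CR: (C \in vset R); last by rewrite /below /= CR !andbF.
suff [z zC [e1 e2]] : exists2 z, z \in C & lt z (f A) = lt z (f B) /\ lt (f A) z = lt (f B) z.
  rewrite (belowE mP CR AR CA zC fAA) (belowE mP CR BR CB zC fBB).
  by rewrite (belowE mP AR CR _ fAA zC) 1?(belowE mP BR CR _ fBB zC) 1?eq_sym.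
case CX: (C \in X).
  have [_ fCC _] := fA C CX; exists (f C) => //; apply: tw; first exact: imset_f.
    by apply: contraNneq CA => /finj->.
  by apply: contraNneq CB => /finj->.
have [z zC] := block_nonempty mP CR; exists z => //; apply: homM => //.
by apply/negP=> zM; rewrite (inX C z) in CX.
Qed.

End Representatives.

Theorem theorem3 (V : finType) (E : rel V)
    (simpleE : irreflexive E) (acyclicE : acyclic E)
    (reducedE : transitively_reduced E)
    (R : digraph {set V})
    (redR : reduces_to (initial E) R) (irrR : irreducible R)
    (M : {set V})
    (pfM : prime_free_module (Digraph [set: V] (trans_closure E)) M) :
  exists2 B : {set V}, B \in vset R & M \subset B.
Proof.
have irr := trans_closure_irr acyclicE; have tr := trans_closure_tr acyclicE.
have qR : quotient_diagram (trans_closure E) R.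
  exact: quotient_diagram_reduces redR (quotient_diagram_initial acyclicE reducedE).
case/andP: pfM => /moduleP[/= M0 _ homM] pf.
apply: (series_parallel_merged irr tr qR irrR M0) => //.
  by move=> x y z; apply: homM; rewrite inE.
pose H := induced (Digraph [set: V] (trans_closure E)) M.
(* [M] is the whole vertex set of [H], so no outside vertex has to be checked. *)
have modM : is_module H M.
  by apply/moduleP; split=> //= x y z ->.
exact: (@prime_free_series_parallel V H irr tr M pf modM).
Qed.
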